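(* Series-parallel posets are full semigroup posets.
   Context: Given posets $P,Q$, the series composition $P*Q$ is the poset obtained from the disjoint union of $P$ and $Q$ by making all elements of $P$ smaller than all elements of $Q$; the parallel composition $P+Q$ is the disjoint union of $P$ and $Q$ with no further comparabilities. A poset is series-parallel if it can be constructed from singletons by (finitely many) series and parallel compositions. A poset is full (a full semigroup poset) if it is isomorphic to $P(S,S)$ for some semigroup $S$, where $P(S,S)$ denotes $S$ with the relation $t\leq_S t' :\iff \exists s\in S:\ ts=t'$, required to be a partial order. *)

(* Defs.v *)
From HB Require Import structures.
From mathcomp Require Import all_boot all_order.
From Stdlib Require Relation_Definitions.

Set Implicit Arguments.
Unset Strict Implicit.
Unset Printing Implicit Defensive.

Import Order.TTheory.

Local Open Scope order_scope.

(* Aliases of the sum type, so that each can carry its own order. *)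
Definition series (P Q : Type) : Type := (P + Q)%type.
Definition parallel (P Q : Type) : Type := (P + Q)%type.

HB.instance Definition _ (P Q : choiceType) :=
  Choice.copy (series P Q) (P + Q)%type.
HB.instance Definition _ (P Q : choiceType) :=
  Choice.copy (parallel P Q) (P + Q)%type.

Section SeriesParallel.
Context {dP dQ : Order.disp_t} {P : porderType dP} {Q : porderType dQ}.

Definition series_le : rel (series P Q) := fun x y =>
  match x, y with
  | inl a, inl b => a <= b
  | inr a, inr b => a <= b
  | inl _, inr _ => true
  | inr _, inl _ => false
  end.

Definition parallel_le : rel (parallel P Q) := fun x y =>
  match x, y with
  | inl a, inl b => a <= b
  | inr a, inr b => a <= b
  | _, _ => false
  end.

Fact series_le_refl : reflexive series_le.
Proof. by case=> x /=. Qed.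

Fact series_le_anti : antisymmetric series_le.
Proof. by case=> x [] y //= /le_anti ->. Qed.

Fact series_le_trans : transitive series_le.
Proof. by case=> y [] x [] z //=; apply: le_trans. Qed.

Fact parallel_le_refl : reflexive parallel_le.
Proof. by case=> x /=. Qed.

Fact parallel_le_anti : antisymmetric parallel_le.
Proof. by case=> x [] y //= /le_anti ->. Qed.

Fact parallel_le_trans : transitive parallel_le.
Proof. by case=> y [] x [] z //=; apply: le_trans. Qed.

End SeriesParallel.

Fact series_display (dP dQ : Order.disp_t) : Order.disp_t.
Proof. exact: Order.Disp tt tt. Qed.

Fact parallel_display (dP dQ : Order.disp_t) : Order.disp_t.
Proof. exact: Order.Disp tt tt. Qed.

HB.instance Definition _ (dP dQ : Order.disp_t)
    (P : porderType dP) (Q : porderType dQ) :=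
  Order.Le_isPOrder.Build (series_display dP dQ) (series P Q)
    series_le_refl series_le_anti series_le_trans.

HB.instance Definition _ (dP dQ : Order.disp_t)
    (P : porderType dP) (Q : porderType dQ) :=
  Order.Le_isPOrder.Build (parallel_display dP dQ) (parallel P Q)
    parallel_le_refl parallel_le_anti parallel_le_trans.

Definition poset_iso (dP dQ : Order.disp_t)
    (P : porderType dP) (Q : porderType dQ) : Prop :=
  exists2 f : P -> Q, bijective f & {mono f : x y / x <= y}.

Inductive series_parallel : forall d : Order.disp_t, porderType d -> Prop :=
| sp_singleton (d : Order.disp_t) (P : porderType d) (x : P) :
    (forall y : P, y = x) -> series_parallel P
| sp_series (dP dQ : Order.disp_t) (P : porderType dP) (Q : porderType dQ) :
    series_parallel P -> series_parallel Q ->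
    series_parallel (series P Q : porderType _)
| sp_parallel (dP dQ : Order.disp_t) (P : porderType dP) (Q : porderType dQ) :
    series_parallel P -> series_parallel Q ->
    series_parallel (parallel P Q : porderType _)
| sp_iso (dP dQ : Order.disp_t) (P : porderType dP) (Q : porderType dQ) :
    poset_iso P Q -> series_parallel P -> series_parallel Q.

Definition semigroup_le (S : semigroupType) : Relation_Definitions.relation S :=
  fun t t' => exists s : S, (t * s)%g = t'.

Definition full_semigroup_poset (d : Order.disp_t) (P : porderType d) : Prop :=
  exists S : semigroupType,
    Relation_Definitions.order S (@semigroup_le S) /\
    exists2 f : P -> S, bijective f &
      forall x y : P, x <= y <-> semigroup_le (f x) (f y).

(* Main.v *)
Require Import Defs.
From HB Require Import structures.
From mathcomp Require Import all_boot all_order.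

(** By induction on the construction, every series-parallel poset [P] carries
    an associative product for which [x <= y] holds exactly when [y] is a right
    multiple of [x]. The induction also has to carry a left zero [m], that is,
    [m * s = m] for all [s]; this is the same as a maximal element of [P], and
    it exists because [P] is finite and nonempty.

    - Series composition of [P] and [Q]: keep both products and let every
      element of [P] act as an identity on [Q], so [p * q = q] and [q * p = q].
      Then [p] has as right multiples those it had in [P], and all of [Q].
    - Parallel composition: keep both products, fix left zeros [m] of [P] and
      [n] of [Q], and set [p * q = p * m] and [q * p = q * n]. No new right
      multiples appear, and associativity holds because [m] and [n] absorb
      whatever is multiplied on their right. *)

Set Implicit Arguments.
Unset Strict Implicit.
Unset Printing Implicit Defensive.

Import Order.TTheory.

Local Open Scope order_scope.

(** An associative product [mul] whose right-divisibility relation is the order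
    of [P], together with a left zero [m]. *)
Definition right_division_product (d : Order.disp_t) (P : porderType d)
    (mul : P -> P -> P) (m : P) : Prop :=
  [/\ associative mul,
      forall x y : P, x <= y <-> exists s, mul x s = y
    & forall s, mul m s = m].

(** Existence of such a product and left zero: the property carried through the
    induction. *)
Definition has_right_division_product (d : Order.disp_t) (P : porderType d) :=
  exists mul m, @right_division_product d P mul m.

Lemma singleton_right_division (d : Order.disp_t) (P : porderType d) (x : P) :
  (forall y : P, y = x) -> has_right_division_product P.
Proof.
move=> Px; exists (fun=> id), x; split=> // y z.
by rewrite (Px y) (Px z) lexx; split=> // _; exists x.
Qed.

Section Compositions.
Context {dP dQ : Order.disp_t} {P : porderType dP} {Q : porderType dQ}.
Variables (mulP : P -> P -> P) (mulQ : Q -> Q -> Q).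

(** Product on the series composition: [P] acts on both sides of [Q] as an
    identity. *)
Definition series_mul (x y : series P Q) : series P Q :=
  match x, y with
  | inl a, inl b => inl (mulP a b)
  | inr a, inr b => inr (mulQ a b)
  | inl _, inr b => inr b
  | inr a, inl _ => inr a
  end.

(** Product on the parallel composition: a factor from the other component acts
    on the right as [m] on [P], and as [n] on [Q]. *)
Definition parallel_mul (m : P) (n : Q) (x y : parallel P Q) : parallel P Q :=
  match x, y with
  | inl a, inl b => inl (mulP a b)
  | inr a, inr b => inr (mulQ a b)
  | inl a, inr _ => inl (mulP a m)
  | inr a, inl _ => inr (mulQ a n)
  end.

Variables (m : P) (n : Q).
Hypotheses (mulP_div : right_division_product mulP m)
           (mulQ_div : right_division_product mulQ n).

Lemma series_mul_right_division :
  @right_division_product _ (series P Q : porderType _) series_mul (inr n).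
Proof.
case: mulP_div mulQ_div => mulPA leP _ [mulQA leQ mulnQ]; split.
- by case=> x [] y [] z //=; rewrite ?mulPA ?mulQA.
- case=> x [] y; rewrite /Order.le /=.
  + split=> [/leP[s <-]|[[] s //= [<-]]]; first by exists (inl s).
    by apply/leP; exists s.
  + by split=> // _; exists (inr y).
  + by split=> // -[[]].
  + split=> [/leQ[s <-]|[[] s //= [<-]]]; first by exists (inr s).
    * exact: lexx.
    * by apply/leQ; exists s.
- by case=> s //=; rewrite mulnQ.
Qed.

Lemma parallel_mul_right_division :
  @right_division_product _ (parallel P Q : porderType _)
    (parallel_mul m n) (inl m).
Proof.
case: mulP_div mulQ_div => mulPA leP mulmP [mulQA leQ mulnQ]; split.
- by case=> x [] y [] z //=; rewrite -?mulPA -?mulQA ?mulmP ?mulnQ.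
- case=> x [] y; rewrite /Order.le /=.
  + split=> [/leP[s <-]|[[] s //= [<-]]]; first by exists (inl s).
    * by apply/leP; exists s.
    * by apply/leP; exists m.
  + by split=> // -[[]].
  + by split=> // -[[]].
  + split=> [/leQ[s <-]|[[] s //= [<-]]]; first by exists (inr s).
    * by apply/leQ; exists n.
    * by apply/leQ; exists s.
- by case=> s /=; rewrite mulmP.
Qed.

End Compositions.

Lemma poset_iso_right_division (dP dQ : Order.disp_t)
    (P : porderType dP) (Q : porderType dQ) :
  poset_iso P Q -> has_right_division_product P -> has_right_division_product Q.
Proof.
move=> [f [g fK gK] f_mono] [mul [m [mulA leP mulm]]].
exists (fun x y => f (mul (g x) (g y))), (f m); split.
- by move=> x y z; rewrite !fK mulA.
- move=> x y; rewrite -[x]gK -[y]gK f_mono !fK; split=> [/leP[s <-]|[s]].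
  + by exists (f s); rewrite fK.
  + by move/(can_inj fK) <-; apply/leP; exists (g s).
- by move=> s; rewrite fK mulm.
Qed.

Lemma series_parallel_right_division (d : Order.disp_t) (P : porderType d) :
  series_parallel P -> has_right_division_product P.
Proof.
elim=> {d P} [d P x Px|dP dQ P Q _ [mP [m Pm]] _ [mQ [n Qn]]
             |dP dQ P Q _ [mP [m Pm]] _ [mQ [n Qn]]|dP dQ P Q PQ _ IH].
- exact: singleton_right_division Px.
- by exists (series_mul mP mQ), (inr n); apply: series_mul_right_division Pm Qn.
- exists (parallel_mul mP mQ m n), (inl m).
  exact: parallel_mul_right_division Pm Qn.
- exact: poset_iso_right_division PQ IH.
Qed.

Lemma right_division_full (d : Order.disp_t) (P : porderType d) :
  has_right_division_product P -> full_semigroup_poset P.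
Proof.
move=> [mul [_ [mulA leP _]]].
pose S : semigroupType := HB.pack (Choice.sort P) (isSemigroup.Build P mulA).
have leS (x y : P) : x <= y <-> @semigroup_le S x y by exact: leP.
exists S; split; last by exists id => //; exists id.
split=> [x|x y z|x y].
- exact/leS.
- by move=> /leS xy /leS yz; apply/leS/(le_trans xy yz).
- by move=> /leS xy /leS yx; apply: le_anti; rewrite xy yx.
Qed.

Theorem corollary4p8 (d : Order.disp_t) (P : porderType d) :
  series_parallel P -> full_semigroup_poset P.
Proof.
by move/series_parallel_right_division; apply: right_division_full.
Qed.
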